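(* Let $G$ be a finite group and $H\leqslant G$. Let $H_2$ be a Sylow $2$-subgroup of $H$, let $N_G(H_2)_2$ be a Sylow $2$-subgroup of the normalizer $N_G(H_2)$, and assume that $P$ is a Sylow $2$-subgroup of $G$ such that $N_G(H_2)_2\leqslant P$. Then the following statements are equivalent: (1) $H_2$ is a perfect code of $P$; (2) $\Omega_1(N_G(H_2)_2/H_2)=\Omega_1(N_G(H_2)_2)H_2$; (3) $\Omega_1(N_G(H_2)/H_2)=\Omega_1(N_G(H_2))H_2$; (4) $H$ is a perfect code of $G$.
   Context: All groups are finite; all graphs are finite, undirected and simple. For a group $G$ and an inverse-closed subset $S\subseteq G\setminus\{1\}$, the Cayley graph $\mathrm{Cay}(G,S)$ has vertex set $G$, with $x,y\in G$ adjacent if and only if $yx^{-1}\in S$. A subset $C$ of the vertex set of a graph $\Gamma$ is a perfect code in $\Gamma$ if $C$ is an independent set and every vertex of $\Gamma$ is at distance at most $1$ from exactly one vertex of $C$. A subgroup $H$ of a group $G$ is called a perfect code of $G$ if there exists a Cayley graph $\mathrm{Cay}(G,S)$ of $G$ in which $H$ is a perfect code. For any finite group $X$, $\Omega_1(X)=\{g\in X: g^2=1\}$ (a set, including the identity, not necessarily a subgroup). For $N\trianglelefteq X$, $\Omega_1(X)N$ denotes $\bigcup_{g\in\Omega_1(X)}Ng$, and the equality $\Omega_1(X/N)=\Omega_1(X)N$ is understood as an equality of collections of cosets of $N$ in $X$: a coset $Nx$ satisfies $(Nx)^2=N$ if and only if $Nx=Ng$ for some $g\in X$ with $g^2=1$.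 Note that $H_2$, being a normal $2$-subgroup of $N_G(H_2)$, is contained in $N_G(H_2)_2$. *)

(* Defs.v *)
From mathcomp Require Import all_boot all_fingroup all_solvable.

Set Implicit Arguments.
Unset Strict Implicit.
Unset Printing Implicit Defensive.

Local Open Scope group_scope.

(* A graph is given by its vertex set V : {set T} and its adjacency relation
   e : rel T, which only relates elements of V (see cayley_adj). *)
Section PerfectCode.

Variables (T : finType) (V : {set T}) (e : rel T).
Implicit Types (C : {set T}) (x y : T).

Definition independent C := {in C &, forall x y, ~~ e x y}.

(* There is a walk of length at most k from x to y. *)
Definition dist_le (k : nat) x y : Prop :=
  exists p : seq T, [/\ path e x p, last x p = y & size p <= k].

Definition perfect_code C : Prop :=
  [/\ C \subset V,
      independent C
    & forall x, x \in V -> exists! c, c \in C /\ dist_le 1 x c].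

End PerfectCode.

Definition connection_set (gT : finGroupType) (G : {group gT})
    (S : {set gT}) : Prop :=
  S \subset G^# /\ {in S, forall s, s^-1 \in S}.

Definition cayley_adj (gT : finGroupType) (G : {group gT})
    (S : {set gT}) : rel gT :=
  fun x y => [&& x \in G, y \in G & y * x^-1 \in S].

Definition subgroup_perfect_code (gT : finGroupType) (G H : {group gT}) : Prop :=
  exists S : {set gT},
    connection_set G S /\ perfect_code G (cayley_adj G S) H.

(* The set of solutions of g ^+ 2 = 1 in X, not the subgroup 'Ohm_1(X) that
   it generates. *)
Definition Omega1 (gT : finGroupType) (X : {set gT}) : {set gT} :=
  [set g in X | g ^+ 2 == 1].

(* Main.v *)
Require Import Defs.
From mathcomp Require Import all_boot all_fingroup all_solvable.

Set Implicit Arguments.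
Unset Strict Implicit.
Unset Printing Implicit Defensive.

Local Open Scope group_scope.

(* H is a perfect code of G iff H has an inverse-closed right transversal in G.
   Such a transversal exists iff every self-inverse double coset HxH made of an
   odd number of right cosets contains a solution of t^2 = 1: an inverse-closed
   set of odd size contains one, and conversely the right cosets in HxH and
   Hx^-1H can be paired off, a leftover coset being represented by a solution of
   t^2 = 1.  The number of right cosets in HxH is |H : H :&: H^x|, which is odd
   iff H :&: H^x contains a Sylow 2-subgroup of H, so Sylow's theorem moves
   x into N_G(H2); there H2 has odd index in N_H(H2), and the conjugacy of the
   reflections of a dihedral group of order 2 mod 4 turns the condition into (3).
   Applied to H2 in P this gives (1) <-> (2), since N_P(H2) is the given Sylow
   subgroup of N_G(H2); Sylow's theorem in N_G(H2) gives (2) <-> (3). *)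

(** * Inverse-closed right transversals and perfect codes *)

(** Discarding a pair x, x^-1 with x^-1 != x preserves the parity of the size. *)
Lemma odd_invol (gT : finGroupType) (A : {set gT}) :
  {in A, forall a, a^-1 \in A} -> odd #|A| -> exists2 t, t \in A & t ^+ 2 = 1.
Proof.
have [n] := ubnP #|A|; elim: n A => // n IHn A ltAn invA oddA.
have /card_gt0P[x Ax] : 0 < #|A| by case: #|A| oddA.
have [x2 | x2] := eqVneq (x ^+ 2) 1; first by exists x.
have neqx : x^-1 != x by apply: contra x2 => /eqP xV; rewrite expgS expg1 -{1}xV mulVg.
have cardA : #|A| = (#|A :\ x :\ x^-1|).+2.
  by rewrite (cardsD1 x) Ax (cardsD1 x^-1 (A :\ x)) !inE neqx invA.
have [|||t] := IHn (A :\ x :\ x^-1).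
- by rewrite -ltnS ltnW // -cardA.
- move=> a; rewrite !inE => /and3P[aV ax Aa]; rewrite invA // andbT.
  by rewrite (inj_eq invg_inj) ax (can2_eq invgK invgK).
- by move: oddA; rewrite cardA /= negbK.
by rewrite !inE => /and3P[_ _ At] t2; exists t.
Qed.

(** A boolean, so that [maxset] can pick a maximal one. *)
Definition partial_transversal (gT : finGroupType) (H T : {set gT}) :=
  [forall s in T, forall t in T, (s \in H :* t) ==> (s == t)].

Definition inv_transversal (gT : finGroupType) (G H T : {set gT}) :=
  [&& T \subset G, [forall t in T, t^-1 \in T], partial_transversal H T &
      [forall x in G, exists t in T, t \in H :* x]].

Lemma partial_transversalP (gT : finGroupType) (H T : {set gT}) :
  reflect {in T &, forall s t, s \in H :* t -> s = t} (partial_transversal H T).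
Proof.
apply: (iffP forall_inP) => [uT s t Ts Tt st | uT s Ts].
  by apply/eqP; move/forall_inP/(_ t Tt)/implyP: (uT s Ts); apply.
by apply/forall_inP => t Tt; apply/implyP => st; apply/eqP/uT.
Qed.

Lemma inv_transversalP (gT : finGroupType) (G H T : {set gT}) :
  reflect [/\ T \subset G, {in T, forall t, t^-1 \in T},
              {in T &, forall s t, s \in H :* t -> s = t}
            & {in G, forall x, exists2 t, t \in T & t \in H :* x}]
          (inv_transversal G H T).
Proof.
apply: (iffP and4P) => [[sTG /forall_inP iT /partial_transversalP uT /forall_inP cT]
                       | [sTG iT uT cT]]; split => //.
- by move=> x /cT/exists_inP.
- exact/forall_inP.
- exact/partial_transversalP.
- by apply/forall_inP => x /cT ?; apply/exists_inP.
Qed.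

Lemma dist_le1P (T : finType) (e : rel T) x y :
  dist_le e 1 x y <-> x = y \/ e x y.
Proof.
split=> [[[|z [|z' p]] [/= exz zy]] // _|[<-|exy]].
- by left.
- by right; rewrite -zy; case/andP: exz.
- by exists [::].
- by exists [:: y]; rewrite /= exy.
Qed.

(** The closed neighbourhood of x is (1 |: S)x, so H meets it once iff 1 |: S meets Hx^-1 once. In
    the other direction, S is T without its element in H. *)
Lemma perfect_code_transversal (gT : finGroupType) (G H : {group gT}) :
  H \subset G ->
  subgroup_perfect_code G H <-> exists T, inv_transversal G H T.
Proof.
move=> sHG; split=> [[S [[sSG iS] [_ indH domH]]] | [T /inv_transversalP[sTG iT uT cT]]].
  have sSG' s : s \in S -> s \in G by move/(subsetP sSG)/setD1P=> [].
  have dist1 x c : x \in G -> c \in G -> c * x^-1 \in 1 |: S ->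
      dist_le (cayley_adj G S) 1 x c.
    move=> Gx Gc; rewrite !inE => /orP[/eqP/divg1_eq -> | Scx];
      apply/dist_le1P; first by left.
    by right; rewrite /cayley_adj Gx Gc.
  exists (1 |: S); apply/inv_transversalP; split.
  - by rewrite subUset sub1G; apply/subsetP.
  - by move=> t; rewrite !inE => /predU1P[->|/iS->]; rewrite ?invg1 ?eqxx ?orbT.
  - move=> s t; rewrite mem_rcoset => Ss St Hst.
    have GS u : u \in 1 |: S -> u \in G by rewrite !inE => /predU1P[->|/sSG'].
    (* Both s * t^-1 and 1 lie in H within distance 1 of the vertex t^-1. *)
    have [c [_ uc]] := domH t^-1 (groupVr (GS t St)).
    apply/divg1_eq; transitivity c; [apply/esym/uc | apply/uc]; split=> //; apply: dist1;
      by rewrite ?group1 ?groupM ?groupV ?GS ?invgK ?mul1g ?mulgKV.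
  - move=> x Gx; have [c [[Hc /dist_le1P dc] _]] := domH x^-1 (groupVr Gx).
    exists (c * x); last by rewrite mem_rcoset mulgK.
    case: dc => [<-|]; first by rewrite mulVg setU11.
    by case/and3P=> _ _; rewrite invgK !inE orbC => ->.
exists (T :\: H); split.
  split=> [|s]; last by rewrite !inE groupV => /andP[-> /iT].
  apply/subsetP => s; rewrite !inE => /andP[nHs Ts]; rewrite (subsetP sTG) // andbT.
  by apply: contraNneq nHs => ->.
split=> // [x y Hx Hy | x Gx].
  by rewrite /cayley_adj !inE groupM ?groupV //= !andbF.
have GH h : h \in H -> h \in G by apply: (subsetP sHG).
have [Hx | nHx] := boolP (x \in H).
  exists x; split=> [|c [Hc /dist_le1P[]//]]; first by split=> //; apply/dist_le1P; left.
  by rewrite /cayley_adj !inE groupM ?groupV //= !andbF.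
have [t Tt] := cT x^-1 (groupVr Gx); rewrite mem_rcoset invgK => Htx.
have nHt : t \notin H by apply: contra nHx => Ht; rewrite -(groupMl _ Ht).
exists (t * x); split.
  split=> //; apply/dist_le1P; right.
  by rewrite /cayley_adj Gx GH //= mulgK !inE nHt.
move=> c [Hc /dist_le1P[xc|]]; first by rewrite xc Hc in nHx.
case/and3P=> _ _; rewrite !inE => /andP[_ Tcx].
suff -> : t = c * x^-1 by rewrite mulgKV.
by apply: uT => //; rewrite mem_rcoset invMg invgK mulgA groupM ?groupV.
Qed.

(** * Double cosets and involutions *)

Section DoubleCosets.

Variables (gT : finGroupType) (H : {group gT}).
Implicit Types (x y t : gT) (T : {set gT}).

Lemma dcosetP x y :
  reflect (exists a b, [/\ a \in H, b \in H & y = a * x * b]) (y \in H :* x * H).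
Proof.
apply: (iffP mulsgP) => [[_ b /rcosetP[a Ha ->] Hb ->]|[a [b [Ha Hb ->]]]].
  by exists a, b.
by exists (a * x) b; rewrite ?mem_rcoset ?mulgK.
Qed.

Lemma dcoset_refl x : x \in H :* x * H.
Proof. by apply/dcosetP; exists 1, 1; rewrite mul1g mulg1 group1. Qed.

Lemma dcosetV x y : (y^-1 \in H :* x^-1 * H) = (y \in H :* x * H).
Proof.
apply/dcosetP/dcosetP=> [] [a [b [Ha Hb def_y]]]; exists b^-1, a^-1;
  rewrite !groupV; split=> //; last by rewrite def_y !invMg mulgA.
by rewrite -[y]invgK def_y !invMg invgK mulgA.
Qed.

Lemma dcosetMl a x y : a \in H -> (a * y \in H :* x * H) = (y \in H :* x * H).
Proof.
by move=> Ha; rewrite -!mulgA; apply/idP/idP=> /mulsgP[h z Hh zD] def_y;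
  apply/mulsgP; [exists (a^-1 * h) z | exists (a * h) z];
  rewrite ?groupM ?groupV // -mulgA -def_y ?mulKg.
Qed.

Lemma dcoset_eq x y : x \in H :* y * H -> H :* x * H = H :* y * H.
Proof.
case/dcosetP=> a [b [Ha Hb ->]]; apply/setP=> z.
apply/dcosetP/dcosetP=> [] [c [d [Hc Hd ->]]].
  by exists (c * a), (b * d); rewrite !groupM // !mulgA.
by exists (c * a^-1), (b^-1 * d); rewrite !groupM ?groupV // !mulgA mulgKV mulgK.
Qed.

(** Conjugating a x b by b^-1 gives b a x. This moves a solution of t^2 = 1 from HxH into Hx. *)
Lemma dcoset_conj x y :
  y \in H :* x * H -> exists2 b, b \in H & y ^ b \in H :* x.
Proof.
case/dcosetP=> a [b [Ha Hb ->]]; exists b^-1; rewrite ?groupV //.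
by rewrite conjgE invgK mulgK mem_rcoset !mulgA mulgK groupM.
Qed.

(** [H :^ x] need not lie in H: the index counts its right cosets that meet H, and left translation
    by x maps these onto the right cosets of H in HxH. *)
Lemma card_rcosets_dcoset x : #|rcosets H (H :* x * H)| = #|H : H :^ x|.
Proof.
have lcE b : x *: (H :^ x :* b) = H :* (x * b).
  by rewrite conjsgE -mulgA lcosetKV rcosetM.
have <-: [set x *: (A : {set gT}) | A in rcosets (H :^ x) H] = rcosets H (H :* x * H).
  apply/setP=> B; apply/imsetP/rcosetsP=> [[_ /rcosetsP[h Hh ->] ->]|].
    exists (x * h); first by apply/dcosetP; exists 1, h; rewrite group1 mul1g.
    by rewrite lcE.
  case=> _ /dcosetP[a [b [Ha Hb ->]]] ->.
  exists (H :^ x :* b); first by apply/rcosetsP; exists b.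
  by rewrite lcE -mulgA rcosetM (rcoset_id Ha).
have injx : injective (fun A : {set gT} => x *: A) := can_inj (lcosetK x).
by rewrite (card_imset _ injx).
Qed.

Lemma card_rcosets_dcosetV x :
  #|rcosets H (H :* x^-1 * H)| = #|rcosets H (H :* x * H)|.
Proof.
rewrite !card_rcosets_dcoset -!divgI; congr (_ %/ _).
by rewrite -(cardJg _ x) conjIg conjsgKV setIC.
Qed.

Lemma card_rcosets_transversal T : partial_transversal H T ->
  #|rcosets H T| = #|T|.
Proof.
move/partial_transversalP=> uT; apply: card_in_imset => s t Ts Tt.
by rewrite !rcosetE => /rcoset_eqP; apply: uT.
Qed.

Lemma partial_transversalS T (D : {set gT}) :
  D \subset T -> partial_transversal H T -> partial_transversal H D.
Proof.
move=> /subsetP sDT /partial_transversalP uT.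
by apply/partial_transversalP=> s t /sDT Ts /sDT Tt; apply: uT.
Qed.

Lemma card_transversal_dcosetV T x : {in T, forall t, t^-1 \in T} ->
  #|T :&: (H :* x^-1 * H)| = #|T :&: (H :* x * H)|.
Proof.
move=> iT; rewrite -(card_invg (T :&: _)); apply: eq_card => t.
rewrite mem_invg !inE dcosetV; congr (_ && _).
by apply/idP/idP=> /iT; rewrite ?invgK.
Qed.

(** As x^-1 lies in HxH, the part of T in HxH is inverse-closed; it has one element in each of the
    oddly many right cosets there. *)
Lemma transversal_dcoset_invol (G : {group gT}) T x :
    H \subset G -> inv_transversal G H T -> x \in G ->
    x^-1 \in H :* x * H -> odd #|H : H :^ x| ->
  exists2 t, t \in H :* x & t ^+ 2 = 1.
Proof.
move=> sHG trT Gx /dcoset_eq xV; rewrite -card_rcosets_dcoset.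
have /inv_transversalP[sTG iT uT cT] := trT; have /and4P[_ _ pT _] := trT.
have ->: rcosets H (H :* x * H) = rcosets H (T :&: (H :* x * H)).
  apply/eqP; rewrite eqEsubset andbC imsetS ?subsetIr //=.
  apply/subsetP=> _ /rcosetsP[y xHy ->].
  have Gy : y \in G.
    by case/dcosetP: xHy => a [b [Ha Hb ->]]; rewrite !groupM // (subsetP sHG).
  have [t Tt yHt] := cT y Gy; apply/rcosetsP; exists t; last exact/esym/rcoset_eqP.
  rewrite inE Tt; case/rcosetP: yHt => h Hh ->; by rewrite dcosetMl.
rewrite card_rcosets_transversal => [odd_T|];
  last exact: partial_transversalS (subsetIl _ _) pT.
have [|t /setIP[_ /dcoset_conj[b Hb xHt]] t2] := odd_invol _ odd_T.
  by move=> t /setIP[/iT Tt xHt]; rewrite inE Tt -xV dcosetV.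
by exists (t ^ b); rewrite // -conjXg t2 conj1g.
Qed.

(** Meant for y = x^-1; the case y = x lets x be its own inverse. *)
Lemma partial_transversalU T x y :
    partial_transversal H T -> {in T, forall t, t \notin H :* x} ->
    {in T, forall t, t \notin H :* y} -> y = x \/ y \notin H :* x ->
  partial_transversal H (T :|: [set x; y]).
Proof.
move=> /partial_transversalP uT Tx Ty xy.
have nx t : t \in T -> t \in H :* x = false by move/Tx/negPf.
have ny t : t \in T -> t \in H :* y = false by move/Ty/negPf.
have nxy : y = x \/ y \in H :* x = false by case: xy => [|/negPf]; auto.
apply/partial_transversalP=> s t; rewrite !inE.
case/or3P=> [Ts|/eqP->|/eqP->] /or3P[Tt|/eqP->|/eqP->] //.
- exact: uT.
- by rewrite nx.
- by rewrite ny.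
- by rewrite rcoset_sym nx.
- by rewrite rcoset_sym; case: nxy => ->.
- by rewrite rcoset_sym ny.
- by case: nxy => ->.
Qed.

(* Take a maximal inverse-closed partial transversal T.  If it missed Hx and some
   other coset Hy of Hx^-1H, then T could be enlarged by z and z^-1 with z in Hx
   and z^-1 in Hy.  So, by counting, Hx is the only coset missed in HxH = Hx^-1H, and T meets
   HxH in one element less than the number of its right cosets: one of the two
   numbers is odd, which puts a solution of t^2 = 1 in HxH, hence in Hx. *)
Lemma exists_inv_transversal (G : {group gT}) : H \subset G ->
    {in G, forall x, x^-1 \in H :* x * H -> odd #|H : H :^ x| ->
       exists2 t, t \in H :* x & t ^+ 2 = 1} ->
  exists T, inv_transversal G H T.
Proof.
move=> sHG Hinv.
pose ok T := [&& T \subset G, [forall t in T, t^-1 \in T] & partial_transversal H T].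
have ok0 : ok set0.
  rewrite /ok sub0set /=; apply/andP; split; first by apply/forall_inP=> t; rewrite inE.
  by apply/partial_transversalP=> t; rewrite inE.
have [T /maxsetP[/and3P[sTG /forall_inP iT pT] maxT] _] := maxset_exists ok0.
exists T; rewrite /inv_transversal sTG pT /=; apply/andP; split; first exact/forall_inP.
apply/forall_inP=> x Gx; apply/exists_inP.
have [/exists_inP // | /exists_inPn Tx] := boolP [exists t in T, t \in H :* x]; exfalso.
have GH h : h \in H -> h \in G by apply: (subsetP sHG).
have aug z : z \in G -> {in T, forall t, t \notin H :* z} ->
    {in T, forall t, t \notin H :* z^-1} -> z^-1 = z \/ z^-1 \notin H :* z -> False.
  move=> Gz Tz TzV zV; suff Tz' : z \in T by have /negP[] := Tz z Tz'; exact: rcoset_refl.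
  suff <-: T :|: [set z; z^-1] = T by rewrite inE set21 orbT.
  apply: maxT; last exact: subsetUl.
    rewrite /ok partial_transversalU // andbT !subUset sTG !sub1set groupV Gz /=.
    apply/forall_inP=> t; rewrite !inE => /or3P[/iT->|/eqP->|/eqP->] //.
      by rewrite eqxx !orbT.
    by rewrite invgK eqxx orbT.
have aug2 z : z \in H :* x -> z ^+ 2 = 1 -> False.
  move=> xHz z2; have zV : z^-1 = z by apply/eqP; rewrite eq_invg_mul -expg2 z2.
  have Gz : z \in G by case/rcosetP: xHz => h Hh ->; rewrite groupM // GH.
  have Tz : {in T, forall t, t \notin H :* z} by rewrite (rcoset_eqP xHz).
  by apply: (aug z) => //; rewrite zV //; left.
have missD y : y \in H :* x^-1 * H -> {in T, forall t, t \notin H :* y} -> y \in H :* x.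
  case/dcosetP=> a [b [Ha Hb def_y]] Ty; apply/negPn/negP=> nxy.
  (* As y = a x^-1 b, the inverse of b^-1 x is a^-1 y. *)
  have xHz : b^-1 * x \in H :* x by rewrite mem_rcoset mulgK groupV.
  have yHz : (b^-1 * x)^-1 \in H :* y.
    by rewrite mem_rcoset def_y !invMg !invgK !mulgA mulgK mulVg mul1g groupV.
  have xHzE := rcoset_eqP xHz; have yHzE := rcoset_eqP yHz.
  apply: (aug (b^-1 * x)); first by rewrite groupM // groupV GH.
  - by rewrite xHzE.
  - by rewrite yHzE.
  by right; rewrite xHzE; apply: contra nxy ; apply: rcoset_trans; rewrite rcoset_sym.
have cardTD y : #|rcosets H (T :&: (H :* y * H))| = #|T :&: (H :* y * H)|.
  by apply: card_rcosets_transversal; apply: partial_transversalS (subsetIl _ _) pT.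
have missx : H :* x \notin rcosets H (T :&: (H :* x * H)).
  apply/rcosetsP=> [[t /setIP[Tt _] xHt]].
  by have /negP[] := Tx t Tt; rewrite xHt rcoset_refl.
have xD : H :* x \in rcosets H (H :* x * H).
  by apply/rcosetsP; exists x; rewrite ?dcoset_refl.
have hit y z : z \in H :* y * H -> [exists t in T, t \in H :* z] ->
    H :* z \in rcosets H (T :&: (H :* y * H)).
  move=> yz /exists_inP[t Tt zt]; apply/rcosetsP; exists t; last exact/esym/rcoset_eqP.
  by rewrite inE Tt; case/rcosetP: zt => h Hh ->; rewrite dcosetMl.
have sTD y : rcosets H (T :&: (H :* y * H)) \subset rcosets H (H :* y * H).
  by rewrite imsetS ?subsetIr.
(* If HxH and Hx^-1H differ, T meets every right coset in Hx^-1H but misses Hx, although inversion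
   gives T equally many elements in both. *)
have [DxV | DxV] := boolP (x^-1 \in H :* x * H); last first.
  have /subset_leq_card : rcosets H (H :* x^-1 * H) \subset
      rcosets H (T :&: (H :* x^-1 * H)).
    apply/subsetP=> _ /rcosetsP[y Dy ->]; apply: hit => //.
    apply: contraNT DxV => /exists_inPn Ty; have /rcosetP[h Hh def_y] := missD y Dy Ty.
    by move: Dy; rewrite def_y dcosetMl // -{1}[x]invgK dcosetV.
  rewrite card_rcosets_dcosetV cardTD card_transversal_dcosetV //.
  rewrite -cardTD leqNgt => /negP[].
  by apply: proper_card; rewrite properE sTD; apply/subsetPn; exists (H :* x).
have defD : rcosets H (H :* x * H) = H :* x |: rcosets H (T :&: (H :* x * H)).
  apply/eqP; rewrite eqEsubset subUset sub1set xD sTD !andbT.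
  apply/subsetP=> _ /rcosetsP[y Dy ->]; rewrite !inE.
  have [/hit-> | /exists_inPn Ty] :=
    boolP [exists t in T, t \in H :* y]; rewrite ?orbT //.
  by rewrite (rcoset_eqP (missD y _ Ty)) ?eqxx // (dcoset_eq DxV).
have cardD : #|rcosets H (H :* x * H)| = #|T :&: (H :* x * H)|.+1.
  by rewrite defD cardsU1 missx cardTD.
have [oddD | evenD] := boolP (odd #|H : H :^ x|).
  by have [t] := Hinv x Gx DxV oddD; apply: aug2.
move: evenD; rewrite -card_rcosets_dcoset cardD /= negbK => /odd_invol[|t].
  by move=> t /setIP[/iT Tt Dt]; rewrite inE Tt -(dcoset_eq DxV) dcosetV.
case/setIP=> _ /dcoset_conj[b Hb xHt] t2.
by apply: (aug2 (t ^ b)); rewrite // -conjXg t2 conj1g.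
Qed.

End DoubleCosets.

(** * Lifting involutions from a quotient *)

(** Solutions of t^2 = 1 always map to solutions, so only lifting is at stake. *)
Lemma Omega1_quotientP (gT : finGroupType) (X K : {group gT}) : K <| X ->
  Omega1 (X / K) = Omega1 X / K <->
  {in X, forall x, x ^+ 2 \in K -> exists2 t, t \in K :* x & t ^+ 2 = 1}.
Proof.
case/andP=> sKX nKX; have nX x : x \in X -> x \in 'N(K) by apply: (subsetP nKX).
split=> [eqO x Xx Kx2 | lift].
  have: coset K x \in Omega1 (X / K).
    apply/setIdP; split; first exact: mem_quotient.
    by rewrite -morphX ?nX //= coset_id.
  rewrite eqO => /morphimP[t Nt /setIdP[Xt /eqP t2] eq_xt].
  by exists t => //; apply/rcoset_kercosetP; rewrite ?nX.
apply/setP=> z; apply/setIdP/morphimP.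
  case=> /morphimP[x Nx Xx ->]; rewrite -morphX //= => /eqP/coset_idr.
  rewrite groupX // => /(_ isT)/(lift x Xx)[t Kxt t2].
  have Xt : t \in X by case/rcosetP: Kxt => k Kk ->; rewrite groupM // (subsetP sKX).
  exists t; [exact: nX | by apply/setIdP; rewrite t2 | ].
  by apply/rcoset_kercosetP; rewrite ?nX // rcoset_sym.
case=> t Nt /setIdP[Xt /eqP t2] ->.
by rewrite mem_quotient // -morphX // t2 morph1.
Qed.

(** With h = y x^-1 inverted by y, conjugating y by h^k gives y h^(2k). For k = n + 1 this is y h =
    x. *)
Lemma dihedral_odd_conj (gT : finGroupType) (x y : gT) n :
    x ^+ 2 = 1 -> y ^+ 2 = 1 -> (y * x^-1) ^+ n.*2.+1 = 1 ->
  y ^ ((y * x^-1) ^+ n.+1) = x.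
Proof.
move=> x2 y2; set h := y * x^-1 => h1.
have xV : x^-1 = x by apply/eqP; rewrite eq_invg_mul -expg2 x2.
have yV : y^-1 = y by apply/eqP; rewrite eq_invg_mul -expg2 y2.
have hy : h ^ y = h^-1 by rewrite /h conjgE invMg invgK yV xV !mulgA -expg2 y2 mul1g.
have hXy k : (h ^+ k)^-1 = y * h ^+ k * y by rewrite -expVgn -hy -conjXg conjgE yV mulgA.
rewrite conjgE hXy -[y * _ * y * _]mulgA (mulgA y y) -expg2 y2 mul1g -mulgA -expgD.
by rewrite addnS addSn addnn expgSr h1 mul1g /h xV mulgA -expg2 y2 mul1g.
Qed.

(** The dihedral argument modulo K: x is an involution only modulo K, but the conjugate of y still
    squares to 1. *)
Lemma dihedral_odd_conj_coset (gT : finGroupType) (K : {group gT}) (x y : gT) n :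
    x \in 'N(K) -> y \in 'N(K) -> x ^+ 2 \in K -> y ^+ 2 = 1 ->
    (y * x^-1) ^+ n.*2.+1 \in K ->
  y ^ ((y * x^-1) ^+ n.+1) \in K :* x.
Proof.
move=> Nx Ny Kx2 y2 Kh.
have Nh : y * x^-1 \in 'N(K) by rewrite groupM ?groupV.
apply/rcoset_kercosetP; rewrite ?groupJ ?groupX //.
rewrite morphJ ?groupX // morphX // morphM ?groupV // morphV //.
apply: dihedral_odd_conj.
- by rewrite -morphX //= coset_id.
- by rewrite -morphX // y2 morph1.
by rewrite -morphV // -morphM ?groupV // -morphX //= coset_id.
Qed.

Lemma expg_index_normal (gT : finGroupType) (K M : {group gT}) h :
  K <| M -> h \in M -> h ^+ #|M : K| \in K.
Proof.
case/andP=> _ nKM Mh; have Nh := subsetP nKM h Mh.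
apply: coset_idr; rewrite ?groupX // morphX // -card_quotient //.
by rewrite expg_cardG // mem_quotient.
Qed.

(** * The criterion in the normaliser of a Sylow 2-subgroup of H *)

Section Criterion.

Variables (gT : finGroupType) (G H Q : {group gT}).
Hypotheses (sHG : H \subset G) (sylQ : 2.-Sylow(H) Q).
Implicit Types (x t : gT).

Let sQH : Q \subset H := pHall_sub sylQ.

Lemma odd_index_normaliser : exists n, #|'N_H(Q) : Q| = n.*2.+1.
Proof.
exists #|'N_H(Q) : Q|./2; rewrite -[LHS]odd_double_half odd_2'nat.
have sylQN : 2.-Sylow('N_H(Q)) Q.
  by rewrite (pHall_subl _ _ sylQ) ?subsetIl // subsetI sQH normG.
by case/and3P: sylQN => _ _ ->.
Qed.

Lemma odd_power_normaliser x : x \in 'N_H(Q) -> exists n, x ^+ n.*2.+1 \in Q.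
Proof.
move=> Hx; have [n idx] := odd_index_normaliser; exists n; rewrite -idx.
by apply: expg_index_normal; rewrite // /normal subsetI sQH normG subsetIr.
Qed.

(** Q lies in H :&: H^x, so the hypothesis gives an involution or 1 in Hx. It is conjugated into
    N(Q) without leaving Hx, then into Qx by the dihedral argument. *)
Lemma involution_of_normalising_coset x :
    {in G, forall x, x^-1 \in H :* x * H -> odd #|H : H :^ x| ->
       exists2 t, t \in H :* x & t ^+ 2 = 1} ->
    x \in 'N_G(Q) -> x ^+ 2 \in Q ->
  exists2 t, t \in Q :* x & t ^+ 2 = 1.
Proof.
move=> Hinv /setIP[Gx NQx] Qx2; have Hx2 := subsetP sQH _ Qx2.
have [||y xHy y2] := Hinv x Gx.
- apply/dcosetP; exists (x ^+ 2)^-1, 1.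
  by rewrite group1 groupV mulg1 expg2 invMg mulgKV.
- rewrite odd_2'nat -indexgI; have /and3P[_ _] := sylQ; apply: pnat_dvd.
  rewrite -(@Lagrange_index _ H (H :&: H :^ x) Q) ?dvdn_mulr ?subsetIl //.
  by rewrite subsetI sQH -{1}(normP NQx) conjSg.
have HyE : H :^ y = H :^ x by case/rcosetP: xHy => h Hh ->; rewrite conjsgM conjGid.
pose K := (H :&: H :^ y)%G.
have sQK : Q \subset K by rewrite subsetI sQH /= HyE -{1}(normP NQx) conjSg.
have nKy : y \in 'N(K).
  by apply/normP; rewrite /= conjIg -conjsgM -expg2 y2 conjsg1 setIC.
have sylQK : 2.-Sylow(K) Q by rewrite (pHall_subl _ _ sylQ) // subsetIl.
have nsKL : K <| K <*> <[y]> by rewrite normalYl cycle_subG.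
(* y lies in a Sylow 2-subgroup R of K<y> and hence normalises the Sylow
   2-subgroup R :&: K of K; conjugating in K turns the latter into Q. *)
have [|R sylR yR] := @Sylow_superset 2 _ (K <*> <[y]>)%G <[y]>%G (joing_subr _ _).
  by rewrite /pgroup (@pnat_dvd _ 2) // order_dvdn y2.
have sylRK := Sylow_setI_normal nsKL sylR.
have [k Kk defQ] := Sylow_trans sylRK sylQK.
have [Hk HyIk] := setIP Kk.
have nRKy : y \in 'N(K :&: R).
  have Ry : y \in R by rewrite -cycle_subG.
  by apply/normP; rewrite conjIg (normP nKy) conjGid.
pose z := y ^ k.
have NQz : z \in 'N(Q) by rewrite defQ normJ memJ_conjg.
have z2 : z ^+ 2 = 1 by rewrite -conjXg y2 conj1g.
(* z y^-1 = k^-1 (y k y^-1), and y k y^-1 is in H because k is in H^y. *)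
have xHz : z \in H :* x.
  rewrite -(rcoset_eqP xHy) mem_rcoset /z conjgE -!mulgA groupMl ?groupV //.
  by rewrite -{1}[y]invgK -conjgE -mem_conjg.
have Hh : z * x^-1 \in 'N_H(Q).
  by rewrite inE -mem_rcoset xHz groupM ?groupV.
have [n Qhn] := odd_power_normaliser Hh.
exists (z ^ ((z * x^-1) ^+ n.+1)); first exact: dihedral_odd_conj_coset.
by rewrite -conjXg z2 conj1g.
Qed.

(** Within HxH, x is replaced by elements closer and closer to the hypothesis: u with square in H, v
    normalising Q as well, w with square in Q. *)
Lemma involution_of_dcoset x :
    {in 'N_G(Q), forall x, x ^+ 2 \in Q -> exists2 t, t \in Q :* x & t ^+ 2 = 1} ->
    x \in G -> x^-1 \in H :* x * H -> odd #|H : H :^ x| ->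
  exists2 t, t \in H :* x & t ^+ 2 = 1.
Proof.
move=> lift Gx xV odd_x.
have GH h : h \in H -> h \in G by apply: (subsetP sHG).
have [a [b [Ha Hb def_xV]]] := dcosetP _ _ _ xV.
(* From x^-1 = a x b follows x a x = b^-1, so u^2 = b^-1 a. *)
pose u := x * a.
have Hu2 : u ^+ 2 \in H.
  suff -> : u ^+ 2 = b^-1 * a by rewrite groupM ?groupV.
  have F : b^-1 = x * a * x.
    by apply: (mulIg b); rewrite mulVg -!mulgA [a * _]mulgA -def_xV mulgV.
  by rewrite F expg2 /u !mulgA.
have Du : u \in H :* x * H by apply/dcosetP; exists 1, a; rewrite group1 mul1g.
have Gu : u \in G by apply: groupM => //; apply: GH.
clearbody u.
pose K := (H :&: H :^ u)%G.
have nKu : u \in 'N(K).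
  by apply/normP; rewrite /= conjIg -conjsgM -expg2 (conjGid Hu2) setIC.
have odd_K : odd #|H : K|.
  by rewrite /= indexgI -card_rcosets_dcoset (dcoset_eq Du) card_rcosets_dcoset.
have [S sylS] := Sylow_exists 2 K.
have sylSH : 2.-Sylow(H) S.
  rewrite pHallE (subset_trans (pHall_sub sylS)) ?subsetIl //=.
  rewrite (card_Hall sylS) -(Lagrange (subsetIl _ _ : K \subset H)) partnM //.
  by rewrite [(#|H : K|`_2)%N]part_p'nat ?muln1 // -odd_2'nat.
have [k Kk defS] : exists2 k, k \in K & S = (S :^ u) :^ k :> {set gT}.
  have sylSu : 2.-Sylow(K) (S :^ u) by rewrite pHallJnorm.
  by have [k Kk defS] := Sylow_trans sylSu sylS; exists k.
have [h Hh defQ] := Sylow_trans sylSH sylQ.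
have Hk := subsetP (subsetIl _ _ : K \subset H) k Kk.
(* u k normalises S, and h carries S to Q. *)
pose v := (u * k) ^ h.
have NQv : v \in 'N(Q).
  by rewrite defQ normJ memJ_conjg; apply/normP; rewrite conjsgM -defS.
have Gv : v \in G by apply: groupJ; [apply: groupM => // | ]; apply: GH.
have Dv : v \in H :* x * H.
  rewrite -(dcoset_eq Du); apply/dcosetP; exists h^-1, (k * h).
  by rewrite groupV groupM // /v conjgE !mulgA.
have Hv2 : v ^+ 2 \in 'N_H(Q).
  rewrite inE (groupX _ NQv) andbT -conjXg groupJr //.
  have -> : (u * k) ^+ 2 = u ^+ 2 * (k ^ u * k) by rewrite !expg2 conjgE !mulgA mulgK.
  have /setIP[Hku _] : k ^ u \in K by rewrite memJ_norm.
  by rewrite groupM // groupM.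
have [n Qvn] := odd_power_normaliser Hv2.
(* The odd power keeps w in HxH, as v^2 is in H, while w^2 = (v^2)^(2n+1) falls into Q. *)
pose w := v ^+ n.*2.+1.
have [||t wQt t2] := lift w.
- by rewrite inE !groupX.
- by rewrite /w -expgM mulnC expgM.
have Dt : t \in H :* x * H.
  case/rcosetP: wQt => q Qq ->; rewrite dcosetMl ?(subsetP sQH) // /w expgSr -mul2n expgM.
  by rewrite dcosetMl // groupX //; case/setIP: Hv2.
have [c Hc xHt] := dcoset_conj Dt.
by exists (t ^ c); rewrite // -conjXg t2 conj1g.
Qed.

Theorem perfect_code_Omega1 :
  subgroup_perfect_code G H <-> Omega1 ('N_G(Q) / Q) = Omega1 'N_G(Q) / Q.
Proof.
have nsQN : Q <| 'N_G(Q) by rewrite /normal subsetI normG (subset_trans sQH) ?subsetIr.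
have [pcT Tpc] := perfect_code_transversal sHG.
have [OL LO] := Omega1_quotientP nsQN.
split=> [/pcT[T trT] | /OL lift].
  apply: LO => x Nx; apply: involution_of_normalising_coset => // y Gy.
  exact: transversal_dcoset_invol trT Gy.
apply: Tpc; apply: exists_inv_transversal => // x Gx.
exact: involution_of_dcoset.
Qed.

End Criterion.

(** * Passage to Sylow subgroups and the equivalences *)

(** N_P(Q) is a p-subgroup of N_G(Q) containing the Sylow subgroup N. *)
Lemma Sylow_normaliser_sub (gT : finGroupType) (p : nat) (G P Q N : {group gT}) :
    p.-Sylow(G) P -> p.-Sylow('N_G(Q)) N -> N \subset P -> 'N_P(Q) = N.
Proof.
move=> sylP sylN sNP; have sNQ := pHall_sub sylN.
have pNP : p.-group 'N_P(Q) by apply: pgroupS (subsetIl _ _) (pHall_pgroup sylP).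
apply: (sub_pHall sylN pNP); last by rewrite setSI // (pHall_sub sylP).
by rewrite subsetI sNP (subset_trans sNQ) ?subsetIr.
Qed.

(** If x^2 is in Q, then x is a 2-element, hence conjugate into N; the lift found there is
    conjugated back, Q being normal. *)
Lemma Omega1_quotient_Sylow (gT : finGroupType) (X N Q : {group gT}) :
    2.-Sylow(X) N -> Q <| X -> Q \subset N ->
  Omega1 (N / Q) = Omega1 N / Q <-> Omega1 (X / Q) = Omega1 X / Q.
Proof.
move=> sylN nsQX sQN; have sNX := pHall_sub sylN.
have nsQN := normalS sQN sNX nsQX; have [_ /subsetP nQX] := andP nsQX.
have p2Q := pgroupS sQN (pHall_pgroup sylN).
have [ON NO] := Omega1_quotientP nsQN; have [OX XO] := Omega1_quotientP nsQX.
split=> [/ON lift | /OX lift]; [apply: XO | apply: NO] => x.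
  move=> Xx Qx2; have p2x : 2.-group <[x]>.
    rewrite /pgroup -orderE; apply: (@pnat_dvd _ (2 * #[x ^+ 2]));
      first by rewrite order_dvdn expgM expg_order.
    by rewrite pnatM pnat_id //; apply: mem_p_elt p2Q Qx2.
  have [|g Xg] := Sylow_Jsub sylN _ p2x; first by rewrite cycle_subG.
  rewrite -cycleJ cycle_subG => Nxg.
  have [|t Qt t2] := lift _ Nxg; first by rewrite -conjXg memJ_norm ?nQX.
  exists (t ^ g^-1); last by rewrite -conjXg t2 conj1g.
  case/rcosetP: Qt => q Qq ->.
  by rewrite conjMg conjgK mem_rcoset mulgK memJ_norm // groupV nQX.
by move=> Nx; apply: lift; rewrite (subsetP sNX).
Qed.

Theorem theorem1p1 (gT : finGroupType) (G H H2 N2 P : {group gT})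
    (sHG : H \subset G)
    (sylH2 : 2.-Sylow(H) H2)
    (sylN2 : 2.-Sylow('N_G(H2)) N2)
    (sylP : 2.-Sylow(G) P)
    (sN2P : N2 \subset P) :
  [<-> subgroup_perfect_code P H2;
       Omega1 (N2 / H2) = Omega1 N2 / H2;
       Omega1 ('N_G(H2) / H2) = Omega1 'N_G(H2) / H2;
       subgroup_perfect_code G H].
Proof.
have p2H2 := pHall_pgroup sylH2; have sH2H := pHall_sub sylH2.
have nsH2N : H2 <| 'N_G(H2).
  by rewrite /normal subsetI normG (subset_trans sH2H) ?subsetIr.
have sH2N2 : H2 \subset N2 by apply: normal_sub_max_pgroup (Hall_max sylN2) p2H2 nsH2N.
(* The criterion is applied to H2 inside P, with H2 as its own Sylow 2-subgroup. *)
have sylH2H2 : 2.-Sylow(H2) H2 by apply: pHall_subl (subxx _) sH2H sylH2.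
have eq12 := perfect_code_Omega1 (subset_trans sH2N2 sN2P) sylH2H2.
rewrite (Sylow_normaliser_sub sylP sylN2 sN2P) in eq12.
have eq23 := Omega1_quotient_Sylow sylN2 nsH2N sH2N2.
have eq34 := perfect_code_Omega1 sHG sylH2.
tfae.
- by case: eq12.
- by case: eq23.
- by case: eq34.
- by move=> pcH; apply/eq12/eq23/eq34.
Qed.
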